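(* Consider the TVD-ES numerical flux between two finite volume subcells with states $\mathbf u_j,\mathbf u_k$, $j<k$, $$\mathbf f_1^{\mathrm{TVD\text{-}ES}}(\mathbf u_j,\mathbf u_k)=\mathbf f_1^{\mathrm{EC}}(\mathbf u_j,\mathbf u_k)-\tfrac12\,\mathcal D^{\mathbf v}\,\langle\!\langle\mathbf v\rangle\!\rangle_{(j,k)},$$ where $\mathbf f_1^{\mathrm{EC}}$ is an entropy conservative flux, $\mathcal D^{\mathbf v}=\mathbf R\,|\boldsymbol\Lambda|\,\mathcal Z\,\mathbf R^T$, and the jump in the reconstructed entropy variables satisfies $$\langle\!\langle\mathbf v\rangle\!\rangle_{(j,k)}=(\mathbf R^T)^{-1}\mathbf B^{\mathrm{ES}}\,\mathbf R^T\,[\![\mathbf v]\!]_{(j,k)}$$ with a diagonal matrix $\mathbf B^{\mathrm{ES}}>0$. Then the entropy production of this flux between the degrees of freedom $j$ and $k$ is $$r_{(j,k)}=-\tfrac12[\![\mathbf v]\!]_{(j,k)}^T\,\mathcal D^{\mathbf v}\,\langle\!\langle\mathbf v\rangle\!\rangle_{(j,k)}=-\tfrac12[\![\mathbf v]\!]_{(j,k)}^T\,\mathbf R\,|\boldsymbol\Lambda|\,\mathcal Z\,\mathbf B^{\mathrm{ES}}\,\mathbf R^T\,[\![\mathbf v]\!]_{(j,k)},$$ and hence $r_{(j,k)}\le0$, i.e. entropy is either conserved or dissipated.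
   Context: The system (e.g. the one-dimensional ideal GLM-MHD equations) has state vector $\mathbf u$, a strictly convex entropy $S(\mathbf u)$, entropy variables $\mathbf v=\partial S/\partial\mathbf u$, a scalar entropy flux potential $\Psi(\mathbf u)$, and two-point numerical non-conservative terms $\boldsymbol\Phi^\Diamond_{(j,k)}=\boldsymbol\Phi^\Diamond(\mathbf u_j,\mathbf u_k)$ (in general not symmetric). $[\![a]\!]_{(j,k)}=a_k-a_j$; a subscript $j$ means evaluation at $\mathbf u_j$. The entropy production of a two-point numerical flux $\hat{\mathbf f}^a$ is $$r_{(j,k)}=[\![\mathbf v]\!]_{(j,k)}^T\hat{\mathbf f}^a_{(j,k)}+\mathbf v_k^T\boldsymbol\Phi^\Diamond_{(k,j)}-\mathbf v_j^T\boldsymbol\Phi^\Diamond_{(j,k)}-[\![\Psi]\!]_{(j,k)}.$$ A flux is entropy conservative if its entropy production vanishes for all pairs of states (generalized Tadmor condition). $\mathbf R$ is the (invertible) matrix of right eigenvectors evaluated on a mean state of $\mathbf u_j,\mathbf u_k$; $\boldsymbol\Lambda$ is the real diagonal matrix of the eigenvalues of the flux and $|\boldsymbol\Lambda|$ its entrywise absolute value; $\mathcal Z$ is a diagonal matrix with positive diagonal entries such that $\mathbf R\,\mathcal Z\,\mathbf R^T=\mathcal H$, where $\mathcal H$ is the entropy Jacobian $\partial\mathbf u/\partial\mathbf v$ on a mean state. ''$\mathbf B^{\mathrm{ES}}>0$'' means that all diagonal entries are positive. *)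

(* Defs.v *)
From HB Require Import structures.
From mathcomp Require Import all_boot all_order all_algebra.
From mathcomp Require Import all_classical all_reals all_analysis.
Set Implicit Arguments.
Unset Strict Implicit.
Unset Printing Implicit Defensive.
Import Order.TTheory GRing.Theory Num.Theory.
Import numFieldNormedType.Exports.
Local Open Scope classical_set_scope.
Local Open Scope ring_scope.

Definition dotv (K : pzRingType) (n : nat) (x y : 'cV[K]_n) : K :=
  (x^T *m y) 0 0.

Definition strictly_convex_on (K : realType) (n : nat) (D : set 'cV[K]_n)
    (S : 'cV[K]_n -> K) : Prop :=
  forall (x y : 'cV[K]_n) (t : K), D x -> D y -> x != y -> 0 < t < 1 ->
    S ((1 - t) *: x + t *: y) < (1 - t) * S x + t * S y.

Definition gradient (K : realType) (n : nat) (S : 'cV[K]_n -> K)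
    (u : 'cV[K]_n) : 'cV[K]_n :=
  \col_i 'D_(delta_mx i 0) (S : 'cV[K]_n -> K^o) u.

(* The library's ['J f u] is for row vectors acting on the left of matrices,
   i.e. the transpose of the Jacobian used here. *)
Definition jacobian_cv (K : realType) (n m : nat) (f : 'cV[K]_n -> 'cV[K]_m)
    (u : 'cV[K]_n) : 'M[K]_(m, n) :=
  \matrix_(i, j) 'D_(delta_mx j 0) f u i 0.

(* A one-dimensional system u_t + f(u)_x + B(u) u_x = 0 on a set of admissible
   states, with a strictly convex entropy.  [cons_of_entropy_vars] is the
   inverse of the change of variables u |-> v = dS/du; it is needed to speak
   about du/dv.  [noncons_num u w] is the two-point term Phi^Diamond(u, w). *)
Record entropy_system (K : realType) (n : nat) := EntropySystem {
  admissible : set 'cV[K]_n.+1 ;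
  admissible_open : open admissible ;
  admissible_convex :
    convex_set (admissible : set (convex_lmodType 'cV[K]_n.+1)) ;
  flux : 'cV[K]_n.+1 -> 'cV[K]_n.+1 ;
  flux_differentiable :
    forall u, admissible u -> differentiable flux u ;
  noncons_matrix : 'cV[K]_n.+1 -> 'M[K]_n.+1 ;
  entropy : 'cV[K]_n.+1 -> K ;
  entropy_differentiable :
    forall u, admissible u -> differentiable (entropy : _ -> K^o) u ;
  entropy_strictly_convex : strictly_convex_on admissible entropy ;
  cons_of_entropy_vars : 'cV[K]_n.+1 -> 'cV[K]_n.+1 ;
  cons_of_entropy_varsK :
    forall u, admissible u -> cons_of_entropy_vars (gradient entropy u) = u ;
  cons_of_entropy_vars_differentiable :
    forall u, admissible u ->
      differentiable cons_of_entropy_vars (gradient entropy u) ;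
  flux_potential : 'cV[K]_n.+1 -> K ;
  noncons_num : 'cV[K]_n.+1 -> 'cV[K]_n.+1 -> 'cV[K]_n.+1
}.

Section EntropySystemTheory.
Variables (K : realType) (n : nat) (sys : entropy_system K n).
Implicit Types (u w fhat jv : 'cV[K]_n.+1) (M : 'M[K]_n.+1).

Definition entropy_vars u : 'cV[K]_n.+1 := gradient (entropy sys) u.

(* With a zero [noncons_matrix] this is the flux Jacobian. *)
Definition system_matrix u : 'M[K]_n.+1 :=
  jacobian_cv (flux sys) u + noncons_matrix sys u.

Definition entropy_jacobian u : 'M[K]_n.+1 :=
  jacobian_cv (cons_of_entropy_vars sys) (entropy_vars u).

Definition jump (V : zmodType) (a : 'cV[K]_n.+1 -> V) u w : V := a w - a u.

(* [fhat] is the value of the numerical flux between the states [u] (left,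
   index j) and [w] (right, index k). *)
Definition entropy_production u w fhat : K :=
  dotv (jump entropy_vars u w) fhat
  + dotv (entropy_vars w) (noncons_num sys w u)
  - dotv (entropy_vars u) (noncons_num sys u w)
  - jump (flux_potential sys) u w.

Definition entropy_conservative (fEC : 'cV[K]_n.+1 -> 'cV[K]_n.+1 -> 'cV[K]_n.+1)
    : Prop :=
  forall u w, admissible sys u -> admissible sys w ->
    entropy_production u w (fEC u w) = 0.

(* Only consistency is required of a mean, so arithmetic, logarithmic, Roe-type
   averages, in any set of variables, are all allowed. *)
Definition mean_state (m : 'cV[K]_n.+1 -> 'cV[K]_n.+1 -> 'cV[K]_n.+1) : Prop :=
  (forall u w, admissible sys u -> admissible sys w -> admissible sys (m u w))
  /\ (forall u, admissible sys u -> m u u = u).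

Definition right_eigenvectors u (Rm Lam : 'M[K]_n.+1) : Prop :=
  [/\ Rm \in unitmx, is_diag_mx Lam & system_matrix u *m Rm = Rm *m Lam].

Definition positive_diag M : Prop := is_diag_mx M /\ forall i, 0 < M i i.

Definition abs_mx M : 'M[K]_n.+1 := map_mx Num.norm M.

Definition dissipation_mx (Rm Lam Z : 'M[K]_n.+1) : 'M[K]_n.+1 :=
  Rm *m abs_mx Lam *m Z *m Rm^T.

(* [jv] is the jump of the reconstructed entropy variables; it depends on
   neighbouring states as well, hence is not a function of [u] and [w]. *)
Definition tvd_es_flux (fEC : 'cV[K]_n.+1 -> 'cV[K]_n.+1 -> 'cV[K]_n.+1)
    (Dv : 'M[K]_n.+1) u w jv : 'cV[K]_n.+1 :=
  fEC u w - 2^-1 *: (Dv *m jv).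

End EntropySystemTheory.

(* Main.v *)
(* The factor R^T of the dissipation matrix cancels the R^-T of the
   reconstructed jump, so the dissipation is a quadratic form in R^T [[v]]
   whose matrix |Lam| Z B is a product of nonnegative diagonal matrices. *)

Require Import Defs.
From mathcomp Require Import all_boot all_order all_algebra.
From mathcomp Require Import all_classical all_reals all_analysis.
From mathcomp Require Import ring.
Import Order.TTheory GRing.Theory Num.Theory.
Local Open Scope ring_scope.

Lemma dotvBr {K : pzRingType} {n : nat} (x y z : 'cV[K]_n) :
  dotv x (y - z) = dotv x y - dotv x z.
Proof. by rewrite /dotv mulmxBr !mxE. Qed.

Lemma dotvZr {K : comPzRingType} {n : nat} (a : K) (x y : 'cV[K]_n) :
  dotv x (a *: y) = a * dotv x y.
Proof. by rewrite /dotv -scalemxAr mxE. Qed.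

(** Serves to move the left factor [Rm] of the dissipation onto the jump, so that [Rm^T] acts on
    both arguments of the form. *)
Lemma dotv_mulmx_tr {K : comPzRingType} {m n : nat} (A : 'M[K]_(m, n))
    (x : 'cV[K]_m) (y : 'cV[K]_n) :
  dotv x (A *m y) = dotv (A^T *m x) y.
Proof. by rewrite /dotv trmx_mul trmxK mulmxA. Qed.

(** Weak counterpart of [positive_diag]: eigenvalues may vanish, so [abs_mx Lam] is in general only
    nonnegative. *)
Definition nonneg_diag {K : numDomainType} {n : nat} (M : 'M[K]_n) : Prop :=
  is_diag_mx M /\ forall i, 0 <= M i i.

(** Diagonal matrices multiply entry by entry; general positive semidefinite matrices have no such
    closure under products. *)
Lemma nonneg_diag_mul {K : numDomainType} {n : nat} {A B : 'M[K]_n} :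
  nonneg_diag A -> nonneg_diag B -> nonneg_diag (A *m B).
Proof.
move=> [/diag_mxP[a ->] a_ge0] [/diag_mxP[b ->] b_ge0].
rewrite mulmx_diag; split; first exact: diag_mx_is_diag.
move=> i; have := mulr_ge0 (a_ge0 i) (b_ge0 i).
by rewrite !mxE eqxx !mulr1n.
Qed.

Lemma dotv_nonneg_diag {K : realDomainType} {n : nat} {M : 'M[K]_n}
    (x : 'cV[K]_n) :
  nonneg_diag M -> 0 <= dotv x (M *m x).
Proof.
move=> [/diag_mxP[d ->] d_ge0]; rewrite /dotv mul_diag_mx mxE.
apply: sumr_ge0 => i _; have := d_ge0 i; rewrite !mxE eqxx mulr1n => di_ge0.
(* Each summand [x_i * (d_i * x_i)] is regrouped as [d_i * x_i ^+ 2]. *)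
by rewrite mulrCA mulr_ge0 // -expr2 sqr_ge0.
Qed.

Lemma positive_diag_nonneg {K : realType} {n : nat} {M : 'M[K]_n.+1} :
  positive_diag M -> nonneg_diag M.
Proof. by move=> [dM M_gt0]; split=> // i; exact: ltW. Qed.

Lemma abs_mx_nonneg_diag {K : realType} {n : nat} {M : 'M[K]_n.+1} :
  is_diag_mx M -> nonneg_diag (abs_mx M).
Proof.
move=> /is_diag_mxP dM; split=> [|i]; last by rewrite mxE normr_ge0.
by apply/is_diag_mxP => i j ij; rewrite mxE dM // normr0.
Qed.

Lemma dissipation_mx_scaled {K : realType} {n : nat}
    {Rm : 'M[K]_n.+1} (Lam Z B : 'M[K]_n.+1) (x : 'cV[K]_n.+1) :
  Rm \in unitmx ->
  dissipation_mx Rm Lam Z *m (invmx Rm^T *m B *m Rm^T *m x)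
    = Rm *m abs_mx Lam *m Z *m B *m Rm^T *m x.
Proof.
by move=> Ru; rewrite /dissipation_mx !mulmxA mulmxK // unitmx_tr.
Qed.

(** The flux enters the entropy production only through the linear term in the jump, so the
    non-conservative and potential terms stay with [f]. *)
Lemma entropy_production_subr {K : realType} {n : nat}
    (sys : entropy_system K n) (u w f g : 'cV[K]_n.+1) :
  entropy_production sys u w (f - g)
    = entropy_production sys u w f - dotv (jump (entropy_vars sys) u w) g.
Proof. by rewrite /entropy_production dotvBr; ring. Qed.

Theorem mainTheorem3 (K : realType) (n : nat) (sys : entropy_system K n)
  (fEC : 'cV[K]_n.+1 -> 'cV[K]_n.+1 -> 'cV[K]_n.+1)
  (hEC : entropy_conservative sys fEC)
  (N : nat) (u : 'I_N -> 'cV[K]_n.+1)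
  (hu : forall i, admissible sys (u i))
  (j k : 'I_N) (hjk : (j < k)%N)
  (meanR meanH : 'cV[K]_n.+1 -> 'cV[K]_n.+1 -> 'cV[K]_n.+1)
  (hmeanR : mean_state sys meanR) (hmeanH : mean_state sys meanH)
  (Rm Lam Z B : 'M[K]_n.+1)
  (hR : right_eigenvectors sys (meanR (u j) (u k)) Rm Lam)
  (hZ : positive_diag Z)
  (hRZ : Rm *m Z *m Rm^T = entropy_jacobian sys (meanH (u j) (u k)))
  (hB : positive_diag B)
  (jv : 'cV[K]_n.+1)
  (hjv : jv = invmx Rm^T *m B *m Rm^T *m jump (entropy_vars sys) (u j) (u k)) :
  let v_jump := jump (entropy_vars sys) (u j) (u k) in
  let Dv := dissipation_mx Rm Lam Z in
  let r := entropy_production sys (u j) (u k)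
             (tvd_es_flux fEC Dv (u j) (u k) jv) in
  [/\ r = - 2^-1 * dotv v_jump (Dv *m jv),
      - 2^-1 * dotv v_jump (Dv *m jv)
        = - 2^-1 * dotv v_jump (Rm *m abs_mx Lam *m Z *m B *m Rm^T *m v_jump)
    & r <= 0].
Proof.
move=> v_jump Dv r; have [Ru dLam _] := hR.
have Djv : Dv *m jv = Rm *m abs_mx Lam *m Z *m B *m Rm^T *m v_jump.
  by rewrite hjv dissipation_mx_scaled.
have rE : r = - 2^-1 * dotv v_jump (Dv *m jv).
  (* Entropy conservation, applied at two admissible states, removes the [fEC] part and leaves the
     dissipation alone. *)
  by rewrite /r entropy_production_subr hEC // sub0r dotvZr mulNr.
split=> //; first by rewrite Djv.
rewrite rE mulNr oppr_le0 mulr_ge0 ?invr_ge0 ?ler0n // Djv.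
(* Isolating the outer [Rm] exposes a quadratic form in [Rm^T *m v_jump] with diagonal matrix
   [abs_mx Lam *m Z *m B]. *)
have -> : Rm *m abs_mx Lam *m Z *m B *m Rm^T *m v_jump
    = Rm *m ((abs_mx Lam *m Z *m B) *m (Rm^T *m v_jump)) by rewrite !mulmxA.
rewrite dotv_mulmx_tr; apply: dotv_nonneg_diag.
by apply: nonneg_diag_mul (positive_diag_nonneg hB);
  apply: nonneg_diag_mul (abs_mx_nonneg_diag dLam) (positive_diag_nonneg hZ).
Qed.
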